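(* Let $M$ be a connected topological manifold of dimension at least $2$ with an effective action of a finite group $G$, let $n\ge 2$, and let ${\bf x}=(x_1,\dots,x_n)\in F_G(M,n)$ be a base point such that every orbit $G(x_i)$ is of free type. Then $\mathcal{B}_n^{orb}(M,G)$ bijectively corresponds to $\pi_1^E(F_G(M,n),{\bf x},{\bf x}^{orb})$ as sets.
   Context: $F_G(M,n)=\{(y_1,\dots,y_n)\in M^{\times n}\mid G(y_i)\cap G(y_j)=\emptyset \text{ for } i\neq j\}$ with the subspace topology; $G^{\times n}$ acts on it coordinatewise. For an $n$-tuple $y$ and $\sigma\in\Sigma_n$ put $y_\sigma=(y_{\sigma(1)},\dots,y_{\sigma(n)})$. An orbit $G(y)$ is of free type if the isotropy group of $y$ is trivial. ${\bf x}^{orb}=\{g{\bf x}_\sigma\mid g\in G^{\times n},\sigma\in\Sigma_n\}$. $I=[0,1]$ carries the trivial $G$-action. A path $\alpha=(\alpha_1,\dots,\alpha_n):I\to F_G(M,n)$ determines the unordered collection of $n$ strings $c(\alpha)=\{c(\alpha_1),\dots,c(\alpha_n)\}$ in $M\times I$, $c(\alpha_i)=\{(\alpha_i(s),s)\mid s\in I\}$, and the unordered collection of orbit strings $\widetilde{c(\alpha)}=\{\widetilde{c(\alpha_1)},\dots,\widetilde{c(\alpha_n)}\}$, where $\widetilde{c(\alpha_i)}=\{h\,c(\alpha_i)\mid h\in G\}$ is a collection of strings. $\widetilde{c(\alpha)}$ is an orbit braid if $\alpha(0)={\bf x}$ and $\alpha(1)\in{\bf x}^{orb}$. For two paths $\alpha,\beta$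 in $F_G(M,n)$ with the same endpoints, $c(\alpha)\sim^G_{iso}c(\beta)$ means that there are continuous maps $\widehat F_i:I\times I\to M\times I$, $\widehat F_i(s,t)=(F_i(s,t),s)$, $i=1,\dots,n$, such that (1) $\coprod_i\widehat F_i(s,0)=c(\alpha)$ and $\coprod_i\widehat F_i(s,1)=c(\beta)$; (2) for all $t$, $\coprod_i\widehat F_i(0,t)=c(\alpha)|_{s=0}=c(\beta)|_{s=0}$ and $\coprod_i\widehat F_i(1,t)=c(\alpha)|_{s=1}=c(\beta)|_{s=1}$; (3) $G(F_i(s,t))\cap G(F_j(s,t))=\emptyset$ for all $(s,t)$ and $i\ne j$. Two orbit braids are equivalent if $c(g\alpha)\sim^G_{iso}c(h\beta)$ for some $g,h\in G^{\times n}$. $\mathcal{B}_n^{orb}(M,G)$ is the set of equivalence classes of orbit braids. $\pi_1^E(F_G(M,n),{\bf x},{\bf x}^{orb})$ is the set of homotopy classes relative to $\partial I$ of paths $\alpha:I\to F_G(M,n)$ with $\alpha(0)={\bf x}$ and $\alpha(1)\in{\bf x}^{orb}$. *)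

(* Defs.v *)
From HB Require Import structures.
From mathcomp Require Import all_boot all_order all_algebra.
From mathcomp Require Import fingroup perm.
From mathcomp Require Import all_classical all_reals all_analysis.
Import Order.TTheory GRing.Theory Num.Theory.
Import numFieldNormedType.Exports.

Set Implicit Arguments.
Unset Strict Implicit.
Unset Printing Implicit Defensive.

Local Open Scope classical_set_scope.
Local Open Scope ring_scope.

(* A set [A : set X] used as a type is [set_type A], which carries the topology
   induced from [X] (subtype_topology.v); all subspaces below are taken so. *)

Definition homeomorphic (X Y : topologicalType) : Prop :=
  exists (f : X -> Y) (g : Y -> X),
    [/\ continuous f, continuous g, cancel f g & cancel g f].

Definition locally_euclidean (R : realType) (d : nat) (M : topologicalType) :=
  forall x : M, exists (U : set M) (V : set 'rV[R]_d),
    [/\ open U, U x, open V & homeomorphic U V].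

Definition topological_manifold (R : realType) (d : nat)
    (M : topologicalType) : Prop :=
  [/\ hausdorff_space M, @second_countable M & locally_euclidean R d M].

(* A left action by continuous maps: as the groups considered are finite, hence
   discrete, this is the same as continuity of [gT * M -> M]. *)
Record gaction (gT : finGroupType) (M : topologicalType) := GAction {
  gact :> gT -> M -> M;
  gact1 : forall y, gact 1%g y = y;
  gactM : forall g h y, gact (g * h)%g y = gact g (gact h y);
  gact_continuous : forall g, continuous (gact g) }.

Definition effective (gT : finGroupType) (M : topologicalType)
    (a : gaction gT M) : Prop :=
  forall g, (forall y, a g y = y) -> g = 1%g.

Definition gorbit (gT : finGroupType) (M : topologicalType)
    (a : gaction gT M) (y : M) : set M := range (fun g => a g y).

Definition isotropy (gT : finGroupType) (M : topologicalType)
    (a : gaction gT M) (y : M) : set gT := [set g | a g y = y].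

Definition free_type (gT : finGroupType) (M : topologicalType)
    (a : gaction gT M) (y : M) : Prop := isotropy a y = [set 1%g].

Definition power (M : topologicalType) (n : nat) : topologicalType :=
  prod_topology (fun _ : 'I_n => M).

Definition tuple_act (gT : finGroupType) (M : topologicalType)
    (a : gaction gT M) (n : nat) (g : 'I_n -> gT) (y : power M n) : power M n :=
  fun i => a (g i) (y i).

Definition tuple_perm (M : topologicalType) (n : nat) (s : 'S_n)
    (y : power M n) : power M n := fun i => y (s i).

(* The orbit configuration space F_G(M,n). *)
Definition FG (gT : finGroupType) (M : topologicalType) (a : gaction gT M)
    (n : nat) : set (power M n) :=
  [set y | forall i j, i != j -> gorbit a (y i) `&` gorbit a (y j) = set0].
Arguments FG {gT M} a n _.

Lemma tuple_act_FG (gT : finGroupType) (M : topologicalType)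
    (a : gaction gT M) (n : nat) (g : 'I_n -> gT) (y : FG a n) :
  FG a n (tuple_act a g (set_val y)).
Proof.
have Fy : FG a n (set_val y) by exact: set_valP.
move=> i j /Fy; rewrite -!subset0 => Fij z [[h _ <-] [k _ e]].
apply: (Fij (a h (a (g i) (set_val y i)))); split.
  by exists (h * g i)%g => //; rewrite gactM.
by exists (k * g j)%g => //; rewrite gactM.
Qed.

Definition FG_act (gT : finGroupType) (M : topologicalType) (a : gaction gT M)
    (n : nat) (g : 'I_n -> gT) (y : FG a n) : FG a n :=
  exist _ (tuple_act a g (set_val y)) (mem_set (tuple_act_FG g y)).

(* x^orb, the set of all g x_sigma. *)
Definition orb_tuples (gT : finGroupType) (M : topologicalType)
    (a : gaction gT M) (n : nat) (x : power M n) : set (power M n) :=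
  [set y | exists (g : 'I_n -> gT) (s : 'S_n),
     y = tuple_act a g (tuple_perm s x)].

Definition unit_itv (R : realType) : set R := `[0, 1].
Arguments unit_itv R _ : clear implicits.

Lemma unit_itv_bounds (R : realType) : unit_itv R 0 /\ unit_itv R 1.
Proof. by rewrite /unit_itv /= !in_itv /= !lexx ler01. Qed.

Definition I0 (R : realType) : unit_itv R :=
  exist _ 0 (mem_set (proj1 (unit_itv_bounds R))).
Definition I1 (R : realType) : unit_itv R :=
  exist _ 1 (mem_set (proj2 (unit_itv_bounds R))).

Section Strings.
Context (R : realType) (gT : finGroupType) (M : topologicalType).
Context (a : gaction gT M) (n : nat).
Local Notation I := (unit_itv R).

Definition string : Type := set (M * I).

Definition string_of (f : I -> M) : string := range (fun s => (f s, s)).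

(* c(alpha), as a set of strings: the n strings of a path in F_G(M,n) are
   pairwise disjoint, so no multiplicities are lost. *)
Definition strings (alpha : I -> FG a n) : set string :=
  range (fun i => string_of (fun s => set_val (alpha s) i)).

Definition strings_at (c : set string) (s0 : I) : set (M * I) :=
  [set p | p.2 = s0 /\ exists2 S, c S & S p].

Definition string_act (h : gT) (S : string) : string :=
  (fun p : M * I => (a h p.1, p.2)) @` S.

Definition orbit_string (S : string) : set string :=
  range (fun h => string_act h S).

(* The orbit strings are collections of strings; the paths may pass through
   points with nontrivial isotropy, where the translates h c(alpha_i) meet, and
   they are not to be replaced by the union of their members. *)
Definition orbit_strings (alpha : I -> FG a n) : set (set string) :=
  orbit_string @` strings alpha.

Definition path_act (g : 'I_n -> gT) (alpha : I -> FG a n) : I -> FG a n :=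
  fun s => FG_act g (alpha s).

Definition string_isotopic (alpha beta : I -> FG a n) : Prop :=
  [/\ alpha (I0 R) = beta (I0 R), alpha (I1 R) = beta (I1 R) &
   exists F : 'I_n -> I * I -> M,
   let Fhat (i : 'I_n) (st : I * I) : M * I := (F i st, st.1) in
   [/\ forall i, continuous (Fhat i),
       range (fun i => range (fun s => Fhat i (s, I0 R))) = strings alpha /\
       range (fun i => range (fun s => Fhat i (s, I1 R))) = strings beta,
       forall t : I,
         [/\ range (fun i => Fhat i (I0 R, t)) = strings_at (strings alpha) (I0 R),
             strings_at (strings alpha) (I0 R) = strings_at (strings beta) (I0 R),
             range (fun i => Fhat i (I1 R, t)) = strings_at (strings alpha) (I1 R) &
             strings_at (strings alpha) (I1 R) = strings_at (strings beta) (I1 R)]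
     & forall (st : I * I) (i j : 'I_n), i != j ->
         gorbit a (F i st) `&` gorbit a (F j st) = set0]].

Definition orb_paths (x : FG a n) : set (I -> FG a n) :=
  [set alpha | [/\ continuous alpha, alpha (I0 R) = x &
                   orb_tuples a (set_val x) (set_val (alpha (I1 R)))]].

Definition orbit_braids (x : FG a n) : set (set (set string)) :=
  orbit_strings @` orb_paths x.

Definition orbit_braid_equiv (x : FG a n) (b b' : set (set string)) : Prop :=
  exists alpha beta : I -> FG a n,
    [/\ orb_paths x alpha, orb_paths x beta,
        b = orbit_strings alpha, b' = orbit_strings beta &
        exists g h : 'I_n -> gT,
          string_isotopic (path_act g alpha) (path_act h beta)].

Definition homotopic_rel (alpha beta : I -> FG a n) : Prop :=
  exists H : I * I -> FG a n,
    [/\ continuous H,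
        forall s, H (s, I0 R) = alpha s /\ H (s, I1 R) = beta s,
        forall t, H (I0 R, t) = alpha (I0 R) &
        forall t, H (I1 R, t) = alpha (I1 R)].

End Strings.
Arguments orb_paths R {gT M a n} x _.
Arguments orbit_braids R {gT M a n} x _.
Arguments orbit_braid_equiv R {gT M a n} x b b'.

Definition classes (T : Type) (A : set T) (E : T -> T -> Prop) : set (set T) :=
  (fun x => [set y | A y /\ E x y]) @` A.

(* B_n^orb(M,G), with base point x. *)
Definition Borb (R : realType) (gT : finGroupType) (M : topologicalType)
    (a : gaction gT M) (n : nat) (x : FG a n) :=
  classes (orbit_braids R x) (orbit_braid_equiv R x).
Arguments Borb R {gT M a n} x _.

(* pi_1^E(F_G(M,n), x, x^orb). *)
Definition pi1E (R : realType) (gT : finGroupType) (M : topologicalType)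
    (a : gaction gT M) (n : nat) (x : FG a n) :=
  classes (orb_paths R x) (@homotopic_rel R gT M a n).
Arguments pi1E R {gT M a n} x _.

(* Main.v *)
Require Import Defs.
From mathcomp Require Import all_boot all_order all_algebra.
From mathcomp Require Import fingroup perm.
From mathcomp Require Import all_classical all_reals all_analysis.
Import numFieldNormedType.Exports.

Set Implicit Arguments.
Unset Strict Implicit.
Unset Printing Implicit Defensive.

Local Open Scope classical_set_scope.
Local Open Scope ring_scope.

(** The base point has free orbits and its coordinates lie in distinct orbits,
so a path starting at [x] is recovered from its orbit braid: among all
translates of all strings, the [i]-th string is the one issuing from [x_i].
Hence orbit braids are the same thing as paths, and it remains to match the two
equivalence relations. A homotopy is an isotopy. Conversely, along an isotopy
from [g alpha] to [h beta] each endpoint moves continuously in a finite set, so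
it is fixed; at time 0 this forces [g = h] and the same labelling of the strings
at both ends, and translating back by [g^-1] gives a homotopy relative to the
endpoints. *)

(** The type [unit_itv R] is the image of the real segment under [valL_], the identity extended by
    the default value [I0 R] off the segment, and this map is continuous on the segment. *)
Lemma connected_unit_itv (R : realType) : connected [set: unit_itv R].
Proof.
rewrite (_ : [set: _] = valL_ (I0 R) (@idfun (unit_itv R)) @` unit_itv R).
  apply: connected_continuous_connected; first exact: segment_connected.
  by apply/subspace_valL_continuousP' => s; exact: cvg_id.
apply/seteqP; split=> // s _; exists (set_val s); first exact: set_valP.
by rewrite -[LHS]/(sigL _ (valL_ _ _) s) valLK.
Qed.

Lemma continuous_pair (T U V : topologicalType) (f : T -> U) (g : T -> V) :
  continuous f -> continuous g -> continuous (fun t => (f t, g t)).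
Proof.
move=> cf cg t.
exact: (@cvg_pair _ _ _ (nbhs t) (nbhs (f t)) (nbhs (g t)) _ _ _ _ _
  (cf t) (cg t)).
Qed.

(** Finite sets are closed in a Hausdorff space, so a fibre of [f] is clopen: its complement is the
    preimage of the finite set [A] minus one point. *)
Lemma connected_finite_range_cst (T U : topologicalType) (A : set U)
    (f : T -> U) :
  connected [set: T] -> hausdorff_space U -> finite_set A ->
  continuous f -> (forall t, A (f t)) -> forall t t', f t = f t'.
Proof.
move=> cT hU fA cf fT t t'.
have clU : forall B : set U, finite_set B -> closed B.
  exact/accessible_finite_set_closed/hausdorff_accessible.
suff e : f @^-1` [set f t'] = [set: T].
  by have : [set: T] t by []; rewrite -e.
apply: cT; first by exists t'.
- exists (~` (f @^-1` (A `\ f t'))); last first.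
    rewrite setTI; apply/seteqP; split=> s /= => [-> [] //|nAs].
    by apply: contrapT => fs; apply: nAs.
  apply: closed_openC; apply: closed_comp; first by move=> s _; exact: cf.
  by apply: clU; exact: finite_setD.
- exists (f @^-1` [set f t']); last by rewrite setTI.
  apply: closed_comp; first by move=> s _; exact: cf.
  by apply: clU; exact: finite_set1.
Qed.

Section orbit_configurations.
Context (gT : finGroupType) (M : topologicalType) (a : gaction gT M) (n : nat).

Lemma gactK (g : gT) : cancel (a g) (a g^-1%g).
Proof. by move=> y; rewrite -gactM mulVg gact1. Qed.

Lemma gact_free_inj (g h : gT) (y : M) :
  free_type a y -> a g y = a h y -> g = h.
Proof.
move=> fy e; apply/eqP; rewrite eq_sym eq_mulVg1 -in_set1.
have : isotropy a y (h^-1 * g)%g by rewrite /isotropy /= gactM e gactK.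
by rewrite fy => /= ->; rewrite in_set1.
Qed.

Lemma FG_ext (y z : FG a n) : (forall i, set_val y i = set_val z i) -> y = z.
Proof. by move=> yz; apply: val_inj; apply/funext. Qed.

Lemma FG_gact_eq (y : FG a n) (i j : 'I_n) (g h : gT) :
  a g (set_val y i) = a h (set_val y j) -> i = j.
Proof.
move=> e; apply/eqP/negP => /negP/(set_valP y) /=; rewrite -subset0.
by move=> /(_ (a g (set_val y i))); apply; split; [exists g|exists h].
Qed.

Lemma FG_coord_continuous (i : 'I_n) :
  continuous (fun y : FG a n => set_val y i).
Proof.
move=> y; apply: (@continuous_comp _ (power M n) _ _ (@proj _ (fun=> M) i)).
  exact: initial_continuous.
exact: (@proj_continuous 'I_n (fun=> M) i).
Qed.

(** The subspace topology and the product topology are both initial, so coordinates detect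
    continuity. *)
Lemma FG_continuous (T : topologicalType) (f : T -> FG a n) :
  (forall i, continuous (fun t => set_val (f t) i)) -> continuous f.
Proof.
move=> cf.
apply: (@continuous_comp_initial _ _ (power M n) (set_val : FG a n -> _)).
move=> t; apply/cvg_sup => i U /= [_ [[V oV <-] Vft]] /filterS; apply.
by apply: cf; exact: open_nbhs_nbhs.
Qed.

End orbit_configurations.

Section orbit_braids.
Context (R : realType) (gT : finGroupType) (M : topologicalType).
Context (a : gaction gT M) (n : nat).
Local Notation I := (unit_itv R).

(** A string is a graph: its second component records the parameter. *)
Lemma string_of_inj : injective (@string_of R M).
Proof.
move=> f g fg; apply/funext => s.
have : string_of g (f s, s) by rewrite -fg; exists s.
by move=> [s' _ [<- ->]].
Qed.

Lemma string_act_of (h : gT) (f : I -> M) :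
  string_act a h (string_of f) = string_of (a h \o f).
Proof. by rewrite /string_act /string_of image_comp. Qed.

Lemma strings_atE (alpha : I -> FG a n) (s : I) :
  strings_at (strings alpha) s = range (fun i => (set_val (alpha s) i, s)).
Proof.
apply/seteqP; split=> [p [ps [_ [i _ <-] [s' _ ep]]]|_ [i _ <-]].
  by move: ps; rewrite -ep /= => <-; exists i.
split=> //; exists (string_of (fun s => set_val (alpha s) i)).
  by exists i.
by exists s.
Qed.

(** The [i]-th string of [alpha] is the translate by some [h] of the [j]-th string of [beta]. At
    time 0 this reads [x_i = h x_j], so disjointness of orbits gives [j = i] and freeness gives
    [h = 1]. *)
Lemma orbit_strings_inj (x : FG a n) (alpha beta : I -> FG a n) :
  (forall i, free_type a (set_val x i)) ->
  alpha (I0 R) = x -> beta (I0 R) = x ->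
  orbit_strings alpha = orbit_strings beta -> alpha = beta.
Proof.
move=> hx a0 b0 ab; apply/funext => s; apply: FG_ext => i.
have : orbit_strings beta
    (orbit_string a (string_of (fun s => set_val (alpha s) i))).
  by rewrite -ab; apply: imageP; exists i.
move=> [_ [j _ <-] e].
have : orbit_string a (string_of (fun s => set_val (beta s) j))
    (string_of (fun s => set_val (alpha s) i)).
  rewrite e; exists 1%g => //; rewrite string_act_of.
  by congr string_of; apply/funext => s' /=; rewrite gact1.
move=> [h _]; rewrite string_act_of => /string_of_inj hab.
have /= := congr1 (@^~ (I0 R)) hab; rewrite a0 b0 => h0.
have := h0; rewrite -[RHS](gact1 a) => h1.
have ji := FG_gact_eq h1; subst j.
have h1' := gact_free_inj (hx i) h1; subst h.
by have /= := congr1 (@^~ s) hab; rewrite gact1.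
Qed.

Lemma homotopic_string_isotopic (alpha beta : I -> FG a n) :
  homotopic_rel alpha beta -> string_isotopic alpha beta.
Proof.
move=> [H [cH Hab H0 H1]].
have Ha s : H (s, I0 R) = alpha s by case: (Hab s).
have Hb s : H (s, I1 R) = beta s by case: (Hab s).
have ab0 : alpha (I0 R) = beta (I0 R) by rewrite -(H0 (I1 R)) Hb.
have ab1 : alpha (I1 R) = beta (I1 R) by rewrite -(H1 (I1 R)) Hb.
split=> //; exists (fun i st => set_val (H st) i); split.
- move=> i; apply: continuous_pair; last by move=> st; exact: cvg_fst.
  move=> st; apply: (@continuous_comp _ _ _ H (fun y => set_val y i)).
    exact: cH.
  exact: FG_coord_continuous.
- by split; apply: eq_imagel => i _; apply: eq_imagel => s _; rewrite ?Ha ?Hb.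
- by move=> t; rewrite !strings_atE H0 H1 ab0 ab1.
- by move=> st i j ij; exact: (set_valP (H st)).
Qed.

Lemma string_isotopic_homotopic (x : FG a n) (g h : 'I_n -> gT)
    (alpha beta : I -> FG a n) :
  hausdorff_space M -> (forall i, free_type a (set_val x i)) ->
  alpha (I0 R) = x -> beta (I0 R) = x ->
  string_isotopic (path_act g alpha) (path_act h beta) ->
  homotopic_rel alpha beta.
Proof.
move=> hM hx a0 b0 [_ _ [F [cF [F0 F1] Fend Fdisj]]].
have cFi i : continuous (F i).
  move=> st; apply: (@continuous_comp _ _ _ (fun st => (F i st, st.1)) fst).
    exact: cF.
  exact: cvg_fst.
(* The isotopy prescribes only the set of endpoints at each [t]; connectedness of the interval keeps
   each endpoint from jumping inside this finite set. *)
have end_cst i (s : I) : s = I0 R \/ s = I1 R ->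
    forall t t', F i (s, t) = F i (s, t').
  move=> sE.
  apply: (@connected_finite_range_cst _ _
    (range (fun j => set_val (path_act g alpha s) j)) (fun t => F i (s, t))).
  - exact: connected_unit_itv.
  - by [].
  - exact: finite_image.
  - move=> t; apply: (@continuous_comp _ _ _ (fun t => (s, t))) => //.
      apply: continuous_pair; first exact: cst_continuous.
      by move=> t'; exact: cvg_id.
    exact: cFi.
  - move=> t; have [] := Fend t; rewrite !strings_atE => e0 _ e1 _.
    have : range (fun j => (set_val (path_act g alpha s) j, s)) (F i (s, t), s).
      by case: sE => ->; rewrite -?e0 -?e1; exists i.
    by move=> [j _ [<-]]; exists j.
(* The families agree only as unordered collections: [p i] is the index in [F] of the string that is
   the [i]-th one of [g alpha] at [t = 0]. *)
have /choice[p pE] : forall i, exists j,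
    forall s, F j (s, I0 R) = a (g i) (set_val (alpha s) i).
  move=> i; have : strings (path_act g alpha)
    (string_of (fun s => set_val (path_act g alpha s) i)) by exists i.
  rewrite -F0 => -[j _ e]; exists j => s.
  exact: (congr1 (@^~ s) (@string_of_inj (fun s => F j (s, I0 R)) _ e)).
have pinj i j : p i = p j -> i = j.
  by move=> pij; apply: (@FG_gact_eq _ _ _ _ (alpha (I0 R)) _ _ (g i) (g j));
    rewrite -!pE pij.
(* At [t = 1] the string [F (p i)] is some [h_j beta_j]. Its starting point has not moved, so
   [g_i x_i = h_j x_j], whence [j = i] and [h_i = g_i]. *)
have qE i s : F (p i) (s, I1 R) = a (g i) (set_val (beta s) i).
  have : strings (path_act h beta) (string_of (fun s => F (p i) (s, I1 R))).
    by rewrite -F1; exists (p i).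
  move=> [j _ /string_of_inj e].
  have {e} Fb s' : F (p i) (s', I1 R) = a (h j) (set_val (beta s') j).
    exact/esym/(congr1 (@^~ s') e).
  have := Fb (I0 R); rewrite (end_cst _ _ _ _ (I0 R)); last by left.
  rewrite pE a0 b0 => /[dup] /FG_gact_eq ij; subst j.
  by move=> /(gact_free_inj (hx i)) ->; exact: Fb.
have KFG st : FG a n (fun i => F (p i) st).
  by move=> i j ij; apply: Fdisj; apply: contra_neq ij; exact: pinj.
(* Relabelling by [p] and translating by the inverse of [g] turns the isotopy into a homotopy from
   [alpha] to [beta]. *)
pose H st := FG_act (fun i => (g i)^-1%g)
  (exist (fun y => y \in FG a n) _ (mem_set (KFG st))).
have HE st i : set_val (H st) i = a (g i)^-1%g (F (p i) st) by [].
exists H; split.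
- apply: FG_continuous => i st.
  by apply: (continuous_comp (cFi (p i) st)); exact: gact_continuous.
- by move=> s; split; apply: FG_ext => i; rewrite HE ?pE ?qE gactK.
- move=> t; apply: FG_ext => i.
  by rewrite HE (end_cst _ _ _ _ (I0 R)) ?pE ?gactK //; left.
- move=> t; apply: FG_ext => i.
  by rewrite HE (end_cst _ _ _ _ (I0 R)) ?pE ?gactK //; right.
Qed.

(** The paths witnessing the equivalence of two orbit braids are the given ones, by
    [orbit_strings_inj]. Conversely a homotopy gives an isotopy with trivial translations
    [g = h = 1]. *)
Lemma orbit_braid_equivE (x : FG a n) (alpha beta : I -> FG a n) :
  hausdorff_space M -> (forall i, free_type a (set_val x i)) ->
  orb_paths R x alpha -> orb_paths R x beta ->
  orbit_braid_equiv R x (orbit_strings alpha) (orbit_strings beta) <->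
  homotopic_rel alpha beta.
Proof.
move=> hM hx xa xb; have [[_ a0 _] [_ b0 _]] := (xa, xb); split.
  move=> [alpha' [beta' [[_ a'0 _] [_ b'0 _] ea eb [g [h gh]]]]].
  rewrite (orbit_strings_inj hx a0 a'0 ea) (orbit_strings_inj hx b0 b'0 eb).
  exact: string_isotopic_homotopic gh.
move=> ab; exists alpha, beta; split=> //.
exists (fun=> 1%g), (fun=> 1%g).
suff act1 (gamma : I -> FG a n) : path_act (fun=> 1%g) gamma = gamma.
  by rewrite !act1; exact: homotopic_string_isotopic.
apply/funext => s; apply: FG_ext => i.
exact: gact1.
Qed.

End orbit_braids.

Lemma classes_image_bij (S T : Type) (A : set S) (B : set T) (E : S -> S -> Prop)
    (E' : T -> T -> Prop) (f : S -> T) :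
  set_bij A B f ->
  (forall s s', A s -> A s' -> E' (f s) (f s') <-> E s s') ->
  set_bij (Defs.classes B E') (Defs.classes A E) (fun C => A `&` f @^-1` C).
Proof.
move=> [fAB finj fsurj] EE'.
have classE s : A s ->
    A `&` f @^-1` [set y | B y /\ E' (f s) y] = [set s' | A s' /\ E s s'].
  move=> As; apply/seteqP; split=> s' /=.
    by move=> [As' [_ /(EE' _ _ As As')]].
  by move=> [As' /(EE' _ _ As As') e]; split=> //; split=> //; exact: fAB.
split.
- by move=> _ [_ /fsurj[s As <-] <-]; rewrite classE //; exists s.
(* Since [f] maps onto [B], a class is the image of its pullback, so pulling back is injective. *)
- have fK C : Defs.classes B E' C -> f @` (A `&` f @^-1` C) = C.
    move=> [b _ <-]; apply/seteqP; split=> [_ [s [_ ?] <-] //|y /= [By Ey]].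
    by have [s As sy] := fsurj y By; exists s => //; split=> //=; rewrite sy.
  by move=> C D; rewrite !inE => /fK CE /fK DE CD; rewrite -CE CD DE.
- move=> _ [s As <-]; exists [set y | B y /\ E' (f s) y]; last exact: classE.
  by exists (f s) => //; exact: fAB.
Qed.

Theorem corollary1 (R : realType) (d : nat) (M : topologicalType)
    (gT : finGroupType) (a : gaction gT M) (n : nat) (x : FG a n)
    (hd : (2 <= d)%N) (hn : (2 <= n)%N)
    (hM : topological_manifold R d M) (cM : connected [set: M])
    (ha : effective a)
    (hx : forall i : 'I_n, free_type a (set_val x i)) :
  exists f : set (set (set (string R M))) -> set (unit_itv R -> FG a n),
    set_bij (Borb R x) (pi1E R x) f.
Proof.
have [hausM _ _] := hM.
(* The bijection sends a class of orbit braids to the set of paths whose orbit braid lies in it. *)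
eexists; apply: (@classes_image_bij _ _ _ _ _ _ (@orbit_strings R _ _ a n)).
  split.
  - by move=> alpha xa; exists alpha.
  - move=> alpha beta; rewrite !inE => -[_ a0 _] [_ b0 _].
    exact: orbit_strings_inj hx a0 b0.
  - by move=> _ [alpha xa <-]; exists alpha.
by move=> alpha beta; exact: orbit_braid_equivE.
Qed.
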